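(* Let $M$ be a proper set system over a finite ground set $V$. Then $M$ is a matroid described by its independent sets if and only if both (1) for each $Y\in M$ and $Y'\subseteq Y$, we have $Y'\in M$, and (2) for each $X\subseteq V$, $\min(M*X)$ is equicardinal.
   Context: A set system is a pair $M=(V,D)$ with $V$ a finite set (the ground set) and $D$ a family of subsets of $V$; it is proper if $D\neq\varnothing$. We write $Y\in M$ for $Y\in D$. $\triangle$ denotes symmetric difference. For $X\subseteq V$, the pivot (twist) of $M$ on $X$ is $M*X=(V,\{Y\triangle X \mid Y\in D\})$. $\min(M)$ is the set system on $V$ whose sets are the members of $D$ that are minimal with respect to inclusion. A set system is equicardinal if all its sets have the same cardinality. ''$M=(V,D)$ is a matroid described by its independent sets'' means that $D$ is the family of independent sets of a matroid on $V$. *)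

(* Defs.v *)
From mathcomp Require Import all_boot.
Set Implicit Arguments.
Unset Strict Implicit.
Unset Printing Implicit Defensive.

(* A set system (V, D) is encoded by its family D : {set {set V}}, the ground
   set being the whole finite type V. *)

Definition symdiff (V : finType) (A B : {set V}) : {set V} :=
  (A :\: B) :|: (B :\: A).

Definition proper_system (V : finType) (D : {set {set V}}) : Prop :=
  D != set0.

Definition twist (V : finType) (D : {set {set V}}) (X : {set V}) :
  {set {set V}} := [set symdiff Y X | Y in D].

(* [minset P Y] includes the condition [P Y]. *)
Definition min_system (V : finType) (D : {set {set V}}) : {set {set V}} :=
  [set Y : {set V} | minset [pred Z | Z \in D] Y].

Definition equicardinal (V : finType) (D : {set {set V}}) : Prop :=
  {in D &, forall Y Z : {set V}, #|Y| = #|Z|}.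

Record matroid (V : finType) := Matroid {
  indep : {set {set V}};
  indep0 : set0 \in indep;
  indep_sub : forall I J : {set V}, J \in indep -> I \subset J -> I \in indep;
  indep_aug : forall I J : {set V}, I \in indep -> J \in indep ->
    #|I| < #|J| -> exists2 x, x \in J :\: I & x |: I \in indep
}.

Definition is_matroid_by_indep (V : finType) (D : {set {set V}}) : Prop :=
  exists M : matroid V, D = indep M.

(* Main.v *)
Require Import Defs.
From mathcomp Require Import all_boot.

(** If the family is closed under subsets, the minimal sets of its twist on X
    are the complements in X of the maximal members contained in X; so
    condition (2) says that all maximal independent subsets of any X have the
    same size, and applying it to X = I :|: J gives augmentation. *)

Lemma symdiff_subset {V : finType} (Y X : {set V}) :
  Y \subset X -> symdiff Y X = X :\: Y.
Proof. by rewrite /symdiff -setD_eq0 => /eqP ->; rewrite set0U. Qed.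

(** Maximality is tested on one-element extensions only; for a family closed under subsets this is
    the same as inclusion-maximality. *)
Definition basis_in {V : finType} (M : {set {set V}}) (X Y : {set V}) : Prop :=
  [/\ Y \in M, Y \subset X & forall x, x \in X :\: Y -> x |: Y \notin M].

Lemma min_twistP {V : finType} (M : {set {set V}}) (X A : {set V}) :
  (forall Y Y' : {set V}, Y \in M -> Y' \subset Y -> Y' \in M) ->
  A \in min_system (twist M X) <-> exists2 Y, basis_in M X Y & A = X :\: Y.
Proof.
move=> down; rewrite inE; split.
  (* Dropping the part of [Y] outside [X] stays in [M] and shrinks the twisted set, so by minimality
     it changes nothing. *)
  case/minsetP=> /imsetP[Y YM ->] minA; exists (Y :&: X); last first.
    rewrite -symdiff_subset ?subsetIr //; apply/esym/minA.
      by apply: imset_f; apply: down YM (subsetIl _ _).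
    by rewrite symdiff_subset ?subsetIr // setDIr setDv setU0 subsetUr.
  have YXM : Y :&: X \in M by apply: down YM (subsetIl _ _).
  split=> [//||x]; first exact: subsetIr.
  case/setDP=> xX xNYX; apply/negP=> xYM.
  have xYX : x |: (Y :&: X) \subset X by rewrite subUset sub1set xX subsetIr.
  (* By minimality again; but [x] lies in the right-hand side and not in the left. *)
  have: X :\: (x |: (Y :&: X)) = symdiff Y X.
    rewrite -symdiff_subset //; apply: minA; first exact: imset_f.
    rewrite symdiff_subset //; apply/subsetP=> z.
    by rewrite !inE => /andP[/norP[_]]; case: (z \in Y); case: (z \in X).
  move/setP/(_ x); move: xNYX; rewrite !inE eqxx xX andbT.
  by move=> /negPf ->.
case=> Y [YM YX maxY] ->; apply/minsetP; split.
  by apply/imsetP; exists Y; rewrite ?symdiff_subset.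
move=> B /imsetP[Z ZM ->] sub.
(* An element of [Z] outside [X] would survive in [symdiff Z X], which lies inside [X]. *)
have ZX : Z \subset X.
  apply/subsetP=> z zZ; apply: contraT => zX.
  by have := subsetP sub z; rewrite !inE zZ (negPf zX) !andbF => /(_ isT).
rewrite symdiff_subset // in sub *.
have YZ : Y \subset Z.
  apply/subsetP=> y yY; apply: contraT => yZ.
  by have := subsetP sub y; rewrite !inE yY yZ (subsetP YX _ yY) => /(_ isT).
congr (_ :\: _); apply/eqP; rewrite eqEsubset YZ andbT.
apply/subsetP=> z zZ; apply: contraT => zY.
have zXY : z \in X :\: Y by rewrite inE zY (subsetP ZX).
case/negP: (maxY z zXY); apply: down ZM _.
by rewrite subUset sub1set zZ.
Qed.

(** Were [Z] smaller, augmentation from [Y] would enlarge it within [X]. Used in both directions,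
    this gives equality. *)
Lemma matroid_basis_leq {V : finType} (M : matroid V) (X Y Z : {set V}) :
  basis_in (indep M) X Y -> basis_in (indep M) X Z -> #|Y| <= #|Z|.
Proof.
case=> YM YX _ [ZM ZX maxZ]; rewrite leqNgt; apply/negP=> ltZY.
have [x /setDP[xY xZ] xZM] := indep_aug ZM YM ltZY.
have xXZ : x \in X :\: Z by rewrite inE xZ (subsetP YX).
by case/negP: (maxZ x xXZ).
Qed.

Theorem corollary4p5 (V : finType) (M : {set {set V}}) (hM : proper_system M) :
  is_matroid_by_indep M <->
  (forall Y Y' : {set V}, Y \in M -> Y' \subset Y -> Y' \in M) /\
  (forall X : {set V}, equicardinal (min_system (twist M X))).
Proof.
split=> [[N ->]|[down equi]].
  have down (Y Y' : {set V}) : Y \in indep N -> Y' \subset Y -> Y' \in indep N.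
    by move=> YN sub; apply: indep_sub YN sub.
  split=> // X A B /(min_twistP _ _ _ down)[Y bY ->].
  case/(min_twistP _ _ _ down)=> Z bZ ->.
  have eqYZ : #|Y| = #|Z|.
    by apply/eqP; rewrite eqn_leq !(matroid_basis_leq N X).
  case: bY bZ => _ YX _ [_ ZX _].
  by rewrite !cardsD (setIidPr YX) (setIidPr ZX) eqYZ.
have M0 : set0 \in M.
  by case/set0Pn: hM => Y YM; apply: down YM (sub0set _).
have sub (I J : {set V}) : J \in M -> I \subset J -> I \in M by apply: down.
have aug (I J : {set V}) : I \in M -> J \in M -> #|I| < #|J| ->
    exists2 x, x \in J :\: I & x |: I \in M.
  move=> IM JM ltIJ.
  case: (pickP [pred x | (x \in J :\: I) && (x |: I \in M)]) => [x|none].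
    by case/andP=> xJI xIM; exists x.
  set X := I :|: J.
  (* If no element of [J :\: I] augments [I], then [I] is maximal in [X], since [X :\: I] equals
     [J :\: I]. *)
  have minI : X :\: I \in min_system (twist M X).
    apply/(min_twistP _ _ _ down); exists I => //.
    split=> // [|x xXI]; first exact: subsetUl.
    by have := none x; rewrite /= -[J :\: I]set0U -(setDv I) -setDUl xXI /= => ->.
  have XJ : X :\: J \in twist M X.
    by apply/imsetP; exists J; rewrite // symdiff_subset ?subsetUr.
  (* [J] itself need not be maximal in [X], so a minimal [W] below [X :\: J] is compared with
     [X :\: I]: equal sizes would force [#|J| <= #|I|]. *)
  have [W minW WXJ] := @minset_exists _ [pred Z | Z \in twist M X] _ XJ.
  have minW' : W \in min_system (twist M X) by rewrite inE.
  have := subset_leq_card WXJ; rewrite (equi X _ _ minW' minI).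
  rewrite !cardsD (setIidPr (subsetUl I J)) (setIidPr (subsetUr I J)).
  by rewrite leqNgt ltn_sub2l // (leq_trans ltIJ) // subset_leq_card ?subsetUr.
by exists (Matroid M0 sub aug).
Qed.
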